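(* Let $P$ be a monic polynomial of degree $d>1$ with non-negative integer coefficients. Let $x\in\mathcal{A}^{\mathbb{Z}}$ be a Toeplitz sequence over a finite alphabet $\mathcal{A}$ with periodic structure $(n_k)_{k\ge1}$ such that $$?_k=o\big(n_k/\rho^P(n_k)\big)\quad\text{as }k\to\infty.$$ Then for every continuous map $F:X_x\to\mathbb{C}$ and every $y\in X_x$ the limit $$\lim_{N\to\infty}\frac{1}{N}\sum_{m\le N}F(S^{P(m)}y)$$ exists.
   Context: For $n\in\mathbb{N}$ let $R^P_n=\{0\le a<n: a\equiv P(m)\bmod n\text{ for some }m\in\mathbb{N}\}$. For $a\in R^P_n$ let $\rho^P(n,a)=\#\{1\le m\le n: P(m)\equiv a\bmod n\}$, and $\rho^P(n)=\max_{a\in R^P_n}\rho^P(n,a)$. $S$ is the left shift on $\mathcal{A}^{\mathbb{Z}}$. A sequence $x$ is Toeplitz if for every $a\in\mathbb{Z}$ there is $\ell\ge1$ with $x(a)=x(a+j\ell)$ for all $j\in\mathbb{Z}$; $X_x$ is the orbit closure of $x$ under $S$. Let $\mathrm{Per}_n(x)=\{a\in\mathbb{Z}:x(a)=x(a+jn)\text{ for all }j\in\mathbb{Z}\}$. A periodic structure of $x$ is a sequence $(n_k)$ with $n_k\mid n_{k+1}$ and $\bigcup_k\mathrm{Per}_{n_k}(x)=\mathbb{Z}$. The number $?_k$ is $\#\{0\le j<n_k: j\notin\mathrm{Per}_{n_k}(x)\}$. The sum $\sum_{m\le N}$ is over natural numbers $1\le m\le N$. *)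

(* Defs.v *)
From HB Require Import structures.
From mathcomp Require Import all_boot all_order all_algebra.
From mathcomp Require Import all_classical all_reals all_analysis.
From mathcomp Require Import complex.

Set Implicit Arguments.
Unset Strict Implicit.
Unset Printing Implicit Defensive.

Import Order.TTheory GRing.Theory Num.Theory.
Import numFieldNormedType.Exports.

Local Open Scope classical_set_scope.
Local Open Scope ring_scope.

(* [R^P_n] *)
Definition residues (P : {poly int}) (n : nat) : {pred 'I_n} :=
  fun a => `[< exists m : nat, (a%:Z = P.[m%:Z] %[mod n%:Z])%Z >].

Arguments residues : clear implicits.

(* [rho^P(n,a)] *)
Definition residue_mult (P : {poly int}) (n a : nat) : nat :=
  count (fun m : nat => (P.[m%:Z] == a%:Z %[mod n%:Z])%Z) (iota 1 n).

(* [rho^P(n)] *)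
Definition max_residue_mult (P : {poly int}) (n : nat) : nat :=
  (\max_(a in residues P n) residue_mult P n a)%N.

(* [A^Z], with the product of the discrete topologies *)
Notation fullshift A := {ptws int -> discrete_topology A}.

Definition left_shift (A : finType) (x : fullshift A) : fullshift A :=
  fun a => x (a + 1).

(* [S^k] for [k] in [Z]; the two lemmas below determine it from [S] *)
Definition left_shift_pow (A : finType) (k : int) (x : fullshift A) :
    fullshift A :=
  fun a => x (a + k).

Lemma left_shift_pow0 (A : finType) (x : fullshift A) : left_shift_pow 0 x = x.
Proof. by apply/funext => a; rewrite /left_shift_pow addr0. Qed.

Lemma left_shift_powS (A : finType) (k : int) (x : fullshift A) :
  left_shift_pow (k + 1) x = left_shift (left_shift_pow k x).
Proof.
by apply/funext => a; rewrite /left_shift /left_shift_pow -addrA (addrC 1).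
Qed.

Definition orbit_closure (A : finType) (x : fullshift A) : set (fullshift A) :=
  closure (range (fun k : int => left_shift_pow k x)).

Definition Per (A : finType) (n : nat) (x : fullshift A) : set int :=
  [set a | forall j : int, x a = x (a + j * n%:Z)].

Definition toeplitz (A : finType) (x : fullshift A) : Prop :=
  forall a : int, exists2 l : nat, (1 <= l)%N & Per l x a.

(* Sequences [(n_k)_{k >= 1}] are indexed from 0: [n k] stands for [n_{k+1}] *)
Definition periodic_structure (A : finType) (x : fullshift A) (n : nat -> nat) :
    Prop :=
  [/\ forall k, (0 < n k)%N,
      forall k, (n k %| n k.+1)%N
    & \bigcup_k Per (n k) x = setT].

(* [?_k] is [holes x (n k)] *)
Definition holes (A : finType) (x : fullshift A) (n : nat) : nat :=
  #|[pred j : 'I_n | `[< ~ Per n x j%:Z >]]|.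

(* Main.v *)
(* Fix a window [-M, M] outside of which coordinates change [F] by at most [e],
   and put [n = n_k].  The point [y] is aligned with [x] modulo [n]: for some
   [r], [y a = x (a + r)] whenever [a + r] is in [Per_n x].  Hence, unless the
   window around [P m + r] meets a hole of [x] modulo [n], [F (S^(P m) y)] is
   determined up to [e] by [m] modulo [n].  The exceptional [m] form an
   [n]-periodic set with at most [(2M+1) * ?_k * rho^P(n)] elements per period,
   which is [o(n)], so the averages are Cauchy. *)
Require Import Defs.
From HB Require Import structures.
From mathcomp Require Import all_boot all_order all_algebra.
From mathcomp Require Import all_classical all_reals all_analysis.
From mathcomp Require Import complex ring lra zify.

Import Order.TTheory GRing.Theory Num.Theory.
Import numFieldNormedType.Exports.

Local Open Scope classical_set_scope.
Local Open Scope ring_scope.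

(** * Averages of periodic and almost periodic real sequences *)

Section Averages.
Context {R : realType}.
Implicit Types (f g : nat -> R) (n N : nat).

Definition average f N : R := N%:R^-1 * \sum_(1 <= m < N.+1) f m.

(** The centred sums [D N] vanish at [N = n], hence are [n]-periodic and bounded, and dividing them
    by [N] gives a null sequence. *)
Lemma periodic_average_cvg g n : (0 < n)%N -> (forall m, g (m + n)%N = g m) ->
  average g N @[N --> \oo] --> average g n.
Proof.
move=> n0 gn; set c := average g n.
pose D N := \sum_(1 <= m < N.+1) (g m - c).
have DE N : D N = \sum_(1 <= m < N.+1) g m - N%:R * c.
  by rewrite /D big_split/= sumr_const_nat subSS subn0 mulNrn mulr_natl.
have Dn : D n = 0.
  by rewrite DE /c /average mulrA divff ?pnatr_eq0 -?lt0n// mul1r subrr.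
have DD N : D (N + n)%N = D N.
  elim: N => [|N IH].
    by rewrite add0n Dn /D big_geq.
  have DS k : D k.+1 = D k + (g k.+1 - c) by rewrite /D big_nat_recr.
  by rewrite addSn !DS IH -addSn gn.
have DM N k : D (k * n + N)%N = D N.
  by elim: k => [|k IH] //; rewrite mulSn -addnA addnC DD.
(* The sum over one period bounds every single value of [|D|]. *)
pose C := \sum_(i < n) `|D i|.
have DC N : `|D N| <= C.
  rewrite (divn_eq N n) DM /C (bigD1 (Ordinal (ltn_pmod N n0)))//=.
  by rewrite lerDl sumr_ge0.
apply/cvgrPdist_le => e e0; near=> N.
have N0 : (0 < N)%N by near: N; exists 1%N.
have NR : (N%:R : R) != 0 by rewrite pnatr_eq0 -lt0n.
rewrite distrC /average.
have -> : N%:R^-1 * \sum_(1 <= m < N.+1) g m - c = D N / N%:R.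
  by rewrite DE; field.
rewrite normrM (ger0_norm (_ : 0 <= N%:R^-1)) ?invr_ge0//.
rewrite ler_pdivrMr ?ltr0n// (le_trans (DC N))// mulrC -ler_pdivrMr//.
by near: N; exact: nbhs_infty_ger.
Unshelve. all: by end_near. Qed.

(* The averages are eventually within a fixed multiple of [e] of the limit of
   those of the periodic sequence [fun m => f (m %% n)], so they are Cauchy. *)
Lemma almost_periodic_average_cvg f (B : R) : (forall m, `|f m| <= B) ->
  (forall e, 0 < e -> exists (n : nat) (E : nat -> bool),
    [/\ (0 < n)%N, forall m, E (m + n)%N = E m,
        (\sum_(1 <= m < n.+1) E m)%N%:R <= e * n%:R
      & forall m, ~~ E m -> `|f m - f (m %% n)%N| <= e]) ->
  cvgn (average f).
Proof.
move=> fB H.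
have B0 : 0 <= B by apply: le_trans (fB 0%N).
apply/cauchy_cvgP; apply: cauchy_exP => e e0.
(* The total error will be at most [d + 2 * B * d + d = 2 * d * (1 + B) = e / 2]. *)
pose d := e / (4 * (1 + B)).
have d0 : 0 < d by rewrite divr_gt0// mulr_gt0//; lra.
have [n [E [n0 En Ed fE]]] := H d d0.
pose g m := f (m %% n)%N.
(* A periodic majorant of [|f - g|]: the error is at most [d] off [E] and trivially at most [2 * B]
   on [E]. *)
pose h m : R := d + 2 * B * (E m)%:R.
have gc := @periodic_average_cvg g n n0
  (fun m => congr1 f (modnDr m n)).
have hc := @periodic_average_cvg h n n0
  (fun m => congr1 (fun b : bool => d + 2 * B * b%:R) (En m)).
have fgh m : `|f m - g m| <= h m.
  rewrite /h; case: (E m) (fE m) => [_|/(_ isT)]; last by rewrite mulr0 addr0.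
  rewrite mulr1 (le_trans (ler_normB _ _))//.
  have := fB m; have := fB (m %% n)%N; rewrite /g; lra.
have hn : average h n <= d + 2 * B * d.
  rewrite /average big_split/= sumr_const_nat subSS subn0 -mulr_sumr -natr_sum.
  rewrite -(mulr_natr d) mulrDr mulrCA mulVf ?pnatr_eq0 -?lt0n// mulr1.
  rewrite lerD2l mulrCA ler_wpM2l ?mulr_ge0//.
  by rewrite mulrC ler_pdivrMr ?ltr0n.
have de : d + 2 * B * d + d < e.
  have : d * (4 * (1 + B)) = e.
    by rewrite /d mulrVK// unitfE; apply/eqP; lra.
  have : 0 <= d * B by rewrite mulr_ge0// ltW.
  lra.
exists (average g n).
move/cvgrPdist_le : gc => /(_ (d / 2)); rewrite divr_gt0// => /(_ isT) gc.
move/cvgrPdist_le : hc => /(_ (d / 2)); rewrite divr_gt0// => /(_ isT) hc.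
suff : \forall N \near \oo, `|average g n - average f N| < e by [].
near=> N.
have gN : `|average g n - average g N| <= d / 2 by near: N.
have hN : `|average h n - average h N| <= d / 2 by near: N.
have fgN : `|average f N - average g N| <= average h N.
  rewrite /average -mulrBr -sumrB normrM ger0_norm ?invr_ge0//.
  rewrite ler_wpM2l ?invr_ge0// (le_trans (ler_norm_sum _ _ _))//.
  exact: ler_sum.
move: gN hN fgN hn de; rewrite !ler_norml ltr_norml.
move=> /andP[? ?] /andP[? ?] /andP[? ?] ? ?; apply/andP; split; lra.
Unshelve. all: by end_near. Qed.

End Averages.

(** * Values of [P] modulo [n] *)

Lemma dvdz_horner_sub (P : {poly int}) (a b : int) : (a - b %| P.[a] - P.[b])%Z.
Proof.
have /factor_theorem[q qE] : root (P - P.[b]%:P) b.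
  by rewrite rootE !hornerE subrr.
have := congr1 (fun p : {poly int} => p.[a]) qE.
by rewrite !hornerE => ->; rewrite dvdz_mull.
Qed.

Lemma ord_modz (n : nat) (a : int) : (0 < n)%N ->
  exists h : 'I_n, h%:Z = (a %% n%:Z)%Z.
Proof.
move=> n0; have n0' : n%:Z != 0 by rewrite eqz_nat -lt0n.
have an : (`|(a %% n%:Z)%Z|%N < n)%N.
  by rewrite -ltz_nat gez0_abs ?modz_ge0// ltz_mod.
by exists (Ordinal an); rewrite /= gez0_abs ?modz_ge0.
Qed.

(** A residue that [P] does not attain has count 0; any other one takes part in the maximum defining
    $\rho^P(n)$. *)
Lemma count_residue_le (P : {poly int}) (n : nat) (a : int) : (0 < n)%N ->
  (count (fun m : nat => (P.[m%:Z] == a %[mod n%:Z])%Z) (iota 1 n)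
   <= max_residue_mult P n)%N.
Proof.
move=> n0; set c := count _ _; case: (posnP c) => [->//|].
rewrite -has_count => /hasP[m _ /eqP ma].
have [h hE] := ord_modz n a n0.
have res : h \in residues P n.
  by apply/asboolP; exists m; rewrite /= hE modz_mod ma.
apply: leq_trans (leq_bigmax_cond _ res).
by rewrite /residue_mult; apply: sub_count => k /=; rewrite hE modz_mod.
Qed.

(** * Counting the times at which the window meets a hole *)

Section Holes.
Context {A : finType} (x : fullshift A) (n : nat) (n0 : (0 < n)%N).

Lemma Per_mod (a b : int) : (a = b %[mod n%:Z])%Z -> Per n x a -> Per n x b.
Proof.
move=> /eqP; rewrite eqz_mod_dvd => /dvdzP[q ab] Pa j.
have -> : b = a - q * n%:Z by rewrite -ab; ring.
rewrite -mulNr -Pa (Pa (j - q)); congr (x _); ring.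
Qed.

Definition is_hole (a : int) : bool := `[< ~ Per n x a >].

Lemma is_hole_mod (a b : int) : (a = b %[mod n%:Z])%Z -> is_hole a = is_hole b.
Proof.
by move=> ab; apply: asbool_equiv_eq; split; apply: contra_not; exact: Per_mod.
Qed.

Lemma is_hole_sum (a : int) :
  (is_hole a <= \sum_(h : 'I_n | is_hole h%:Z) (a == h%:Z %[mod n%:Z])%Z)%N.
Proof.
case: (boolP (is_hole a)) => // Ha.
have [h hE] := ord_modz n a n0.
have ha : (h%:Z = a %[mod n%:Z])%Z by rewrite hE modz_mod.
have Hh : is_hole h%:Z by rewrite (is_hole_mod _ _ ha).
by rewrite (bigD1 h Hh)/= ha eqxx.
Qed.

Lemma holesE : holes x n = #|[pred h : 'I_n | is_hole h%:Z]|.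
Proof. by []. Qed.

Context (P : {poly int}) (M : nat) (r : int).

(** The offsets [i - M] with [i <= 2M] run through the window [[-M, M]]; a finite index type makes
    the predicate boolean and summable. *)
Definition hits_hole (m : nat) : bool :=
  [exists i : 'I_(M.*2.+1), is_hole (P.[m%:Z] + (r + i%:Z - M%:Z))].

Lemma hits_hole_periodic m : hits_hole (m + n) = hits_hole m.
Proof.
apply: eq_existsb => i; apply: is_hole_mod; apply/eqP; rewrite eqz_mod_dvd.
have -> : forall u v w : int, u + w - (v + w) = u - v by move=> *; ring.
by apply: dvdz_trans (dvdz_horner_sub _ _ _); rewrite PoszD addrC addKr.
Qed.

(** Union bound over the [2M+1] window positions and the hole residues [h]: for each pair, the [m]
    in question solve one congruence for [P m], so there are at most $\rho^P(n)$ of them. *)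
Lemma sum_hits_hole_le :
  (\sum_(1 <= m < n.+1) hits_hole m
   <= M.*2.+1 * (holes x n * max_residue_mult P n))%N.
Proof.
have hit m : (hits_hole m <= \sum_(i < M.*2.+1)
    is_hole (P.[m%:Z] + (r + i%:Z - M%:Z)))%N.
  case: (boolP (hits_hole m)) => // /existsP[i Hi].
  by rewrite (bigD1 i)//= Hi.
apply: (@leq_trans (\sum_(1 <= m < n.+1) \sum_(i < M.*2.+1)
    is_hole (P.[m%:Z] + (r + i%:Z - M%:Z)))%N); first exact: leq_sum.
rewrite exchange_big/= -[X in (_ <= X * _)%N]card_ord -sum_nat_const.
apply: leq_sum => i _; set c := r + _ - _.
apply: (@leq_trans (\sum_(1 <= m < n.+1) \sum_(h : 'I_n | is_hole h%:Z)
    (P.[m%:Z] + c == h%:Z %[mod n%:Z])%Z)%N).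
  by apply: leq_sum => m _; exact: is_hole_sum.
rewrite exchange_big/= holesE -sum_nat_const.
apply: leq_sum => h _.
apply: leq_trans (count_residue_le P n (h%:Z - c) n0).
rewrite -sum1_count /index_iota subSS subn0 [leqRHS]big_mkcond/=.
apply: leq_sum => m _.
suff -> : (P.[m%:Z] + c == h%:Z %[mod n%:Z])%Z =
  (P.[m%:Z] == h%:Z - c %[mod n%:Z])%Z by case: ifP.
by rewrite !eqz_mod_dvd; congr (_ %| _)%Z; ring.
Qed.

End Holes.

(** * Topology of the full shift and of orbit closures *)

Section FullShift.
Context {A : finType}.
Implicit Types (x y z w : fullshift A) (M : nat).

Definition agree M z w := forall i : int, (`|i| <= M)%N -> z i = w i.

Lemma nbhs_agree z M : nbhs z (agree M z).
Proof.
have ev (i : int) : \forall w \near z, z i = w i.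
  have := @proj_continuous _ (fun _ : int => discrete_topology A) i z.
  by move=> /(_ [set a | z i = a]); apply.
elim: M => [|M IH].
  by apply: (@filterS _ _ (nbhs_filter z) _ _ _ (ev 0)) => w zw i; rewrite leqn0 absz_eq0 => /eqP->.
have zM := @filterI _ _ (nbhs_filter z) _ _ IH
  (@filterI _ _ (nbhs_filter z) _ _ (ev M.+1%:Z) (ev (- M.+1%:Z))).
apply: (@filterS _ _ (nbhs_filter z) _ _ _ zM) => w [zw [wM wNM]] i; rewrite leq_eqVlt ltnS => /orP[|/zw//].
by case: (intP i) => // k; rewrite ?abszN => /eqP/= [->].
Qed.

(** The filter generated by the windows [agree M z] converges to [z] in each coordinate, hence in
    the product topology. With [nbhs_agree], these windows form a neighbourhood base. *)
Lemma agree_nbhs z (U : set (fullshift A)) : nbhs z U ->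
  exists M, agree M z `<=` U.
Proof.
pose G : set_system (fullshift A) := filter_from setT (fun M => agree M z).
have FG : Filter G.
  apply: filter_from_filter; first by exists 0%N.
  move=> i j _ _; exists (maxn i j) => // w zw; split => k kM; apply: zw.
    by rewrite leq_max kM.
  by rewrite leq_max kM orbT.
suff Gz : G --> z by move=> /Gz[M _]; exists M.
apply/cvg_sup => i; move=> V /= [W [[B oB <-] Bz BV]].
exists `|i|%N => // w zw; apply: BV => /=.
by rewrite -zw.
Qed.

Lemma orbit_closureP x y :
  orbit_closure x y <-> forall M, exists k : int, agree M y (left_shift_pow k x).
Proof.
split=> [xy M|xy B /agree_nbhs[M MB]].
  have [_ [[k _ <-] yk]] := xy _ (nbhs_agree y M).
  by exists k.
by have [k yk] := xy M; exists (left_shift_pow k x); split; [exists k|exact: MB].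
Qed.

Lemma orbit_closure_shift x y (k : int) :
  orbit_closure x y -> orbit_closure x (left_shift_pow k y).
Proof.
move=> /orbit_closureP xy; apply/orbit_closureP => M.
(* The window is enlarged so that it still covers [[-M, M]] after a shift by [k]. *)
have [j yj] := xy (M + `|k|)%N; exists (k + j) => i iM.
rewrite /left_shift_pow addrA; apply: yj.
by lia.
Qed.

Lemma orbit_closure_compact x : compact (orbit_closure x).
Proof.
apply: (@subclosed_compact _ _ setT) => //; first exact: closed_closure.
have := @tychonoff int (fun=> discrete_topology A) (fun=> setT)
  (fun=> @finite_compact (discrete_topology A) setT (@finite_finset A setT)).
by congr compact; apply/seteqP; split.
Qed.

Lemma within_continuous_agree {R : realType} (X : set (fullshift A))
    (G : fullshift A -> R) z (e : R) :
  {within X, continuous G} -> X z -> 0 < e ->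
  exists M, forall w, X w -> agree M z w -> `|G z - G w| < e.
Proof.
move=> /subspace_continuousP Gc Xz e0.
have /cvgrPdist_lt/(_ e e0)/agree_nbhs[M zM] := Gc z Xz.
by exists M => w Xw zw; exact: zM.
Qed.

(** Otherwise there are bad pairs agreeing on ever larger windows. Near a cluster point [z] of their
    first components, both members of some pair have values within [e / 2] of [G z], a
    contradiction. *)
Lemma unif_continuous_agree {R : realType} (X : set (fullshift A))
    (G : fullshift A -> R) (e : R) :
  compact X -> {within X, continuous G} -> 0 < e ->
  exists M, forall z w, X z -> X w -> agree M z w -> `|G z - G w| <= e.
Proof.
move=> cX Gc e0; apply/not_existsP => nM.
have /choice[u uP] M : exists zw : fullshift A * fullshift A,
    [/\ X zw.1, X zw.2, agree M zw.1 zw.2 & e < `|G zw.1 - G zw.2|].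
  have /existsNP[z /existsNP[w]] := nM M.
  move=> /not_implyP[Xz /not_implyP[Xw /not_implyP[zw /negP]]].
  by rewrite -ltNge => ?; exists (z, w).
have [|z [Xz zc]] := cX ((fun M => (u M).1) @ \oo).
  by exists 0%N => // M _ /=; case: (uP M).
have [M zM] := @within_continuous_agree _ X G z (e / 2) Gc Xz (divr_gt0 e0 (ltr0n _ 2)).
(* Clustering along a tail yields an index [N >= M], so that the second component of the pair also
   agrees with [z] on [[-M, M]]. *)
have MN : ((fun M => (u M).1) @ \oo) [set w | exists N, (M <= N)%N /\ w = (u N).1].
  by exists M => // N /= MN; exists N.
have [_ [[N [MN' ->]] zuN]] := zc _ _ MN (nbhs_agree z M).
have [Xu1 Xu2 u12 eu] := uP N.
have a1 := zM _ Xu1 zuN.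
have zu2 : agree M z (u N).2.
  by move=> i iM; rewrite zuN// u12// (leq_trans iM).
have a2 := zM _ Xu2 zu2.
have := ler_distD (G z) (G (u N).1) (G (u N).2).
rewrite (distrC _ (G z)); lra.
Qed.

Lemma within_continuous_bounded {R : realType} (X : set (fullshift A))
    (G : fullshift A -> R) :
  compact X -> {within X, continuous G} ->
  exists B, forall z, X z -> `|G z| <= B.
Proof.
move=> cX Gc.
have [B [_ BP]] := compact_bounded (continuous_compact Gc cX).
by exists (B + 1) => z Xz; apply: BP; [lra|exists z].
Qed.

(* Otherwise each residue [r] modulo [n] fails at some position; a shift of [x]
   agreeing with [y] on a window that contains these [n] positions
   contradicts the failure of its own residue. *)
Lemma orbit_closure_aligned x y n : (0 < n)%N -> orbit_closure x y ->
  exists r : int, forall a, Per n x (a + r) -> y a = x (a + r).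
Proof.
move=> n0 /orbit_closureP xy; apply/not_existsP => nr.
have /choice[a aP] (r : 'I_n) : exists a, Per n x (a + r%:Z) /\ y a <> x (a + r%:Z).
  by have /existsNP[a /not_implyP] := nr r%:Z; exists a.
have [k yk] := xy (\max_(r < n) `|a r|)%N.
have [h hE] := ord_modz n k n0; have [Pr yr] := aP h.
apply: yr; rewrite yk; last exact: (leq_bigmax h).
rewrite (Pr (k %/ n%:Z)%Z) /left_shift_pow [in LHS](divz_eq k n%:Z) hE.
by congr (x _); ring.
Qed.

End FullShift.

(** * Convergence in [R[i]] through real and imaginary parts *)

Section Complex.
Context {R : realType}.

Lemma normc_ge_Im (z : R[i]) : `|complex.Im z|%:C%C <= `|z|.
Proof.
by rewrite normc_def lecR -sqrtr_sqr ler_wsqrtr// lerDr sqr_ge0.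
Qed.

Lemma normc_le_ReIm (z : R[i]) :
  `|z| <= (`|complex.Re z| + `|complex.Im z|)%:C%C.
Proof.
case: z => a b /=.
have -> : (a +i* b)%C = (a +i* 0)%C + (0 +i* b)%C by simpc.
apply: le_trans (ler_normD _ _) _.
by rewrite !normc_def /= expr0n /= addr0 add0r !sqrtr_sqr -raddfD.
Qed.

Lemma Re_continuous : continuous (@complex.Re R : R[i]^o -> R).
Proof.
move=> z; apply/(@cvgrPdist_le _ _ _ _ (nbhs_filter z)) => e e0.
have ze : nbhs z (ball z e%:C%C) by apply: nbhsx_ballx; rewrite ltcR.
apply: (@filterS _ _ (nbhs_filter z) _ _ _ ze) => w /= /ltW zw.
rewrite -lecR; apply: le_trans zw.
by have := normc_ge_Re (z - w); rewrite raddfB.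
Qed.

Lemma Im_continuous : continuous (@complex.Im R : R[i]^o -> R).
Proof.
move=> z; apply/(@cvgrPdist_le _ _ _ _ (nbhs_filter z)) => e e0.
have ze : nbhs z (ball z e%:C%C) by apply: nbhsx_ballx; rewrite ltcR.
apply: (@filterS _ _ (nbhs_filter z) _ _ _ ze) => w /= /ltW zw.
rewrite -lecR; apply: le_trans zw.
by have := normc_ge_Im (z - w); rewrite raddfB.
Qed.

Lemma cvg_ReIm {T : Type} (G : set_system T) (f : T -> R[i]^o) (a b : R) :
  Filter G -> complex.Re (f t) @[t --> G] --> a ->
  complex.Im (f t) @[t --> G] --> b -> f t @[t --> G] --> ((a +i* b)%C : R[i]^o).
Proof.
move=> FG fa fb; apply/cvgrPdist_le => e e0.
(* Here [e] lives in [R[i]], whose order compares only numbers with equal imaginary parts; a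
   positive [e] is therefore real. *)
have [d d0 de] : exists2 d : R, 0 < d & e = d%:C%C.
  case: e e0 => d i; rewrite ltcE /= => /andP[/eqP -> d0]; by exists d.
have d20 : 0 < d / 2 by rewrite divr_gt0.
move/cvgrPdist_le : fa => /(_ _ d20) fa; move/cvgrPdist_le : fb => /(_ _ d20) fb.
near=> t.
have fat : `|a - complex.Re (f t)| <= d / 2 by near: t.
have fbt : `|b - complex.Im (f t)| <= d / 2 by near: t.
apply: le_trans (normc_le_ReIm _) _.
by rewrite de lecR !raddfB /=; lra.
Unshelve. all: by end_near. Qed.

End Complex.

(** * Averages of a real observable along [P] *)

Section PolynomialAverages.
Context {R : realType} {A : finType} (x y : fullshift A).
Context (P : {poly int}) (n : nat -> nat) (G : fullshift A -> R).

Lemma polynomial_average_cvg :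
  (forall k, (0 < n k)%N) ->
  (fun k : nat => (holes x (n k))%:R : R) =o_\oo
    (fun k : nat => (n k)%:R / (max_residue_mult P (n k))%:R : R) ->
  {within orbit_closure x, continuous G} -> orbit_closure x y ->
  cvgn (average (fun m => G (left_shift_pow P.[m%:Z] y))).
Proof.
move=> n0 /eqoP hn Gc xy; have cX := orbit_closure_compact x.
have [B BP] := within_continuous_bounded _ _ cX Gc.
apply: (@almost_periodic_average_cvg _ _ B) => [m|e e0].
  by apply: BP; exact: orbit_closure_shift.
have [M MP] := unif_continuous_agree _ _ _ cX Gc e0.
have M0 : 0 < (M.*2.+1)%:R :> R by rewrite ltr0n.
(* Dividing [e] by the window length absorbs the factor [2M+1] in the count of exceptional times. *)
have [k _ /(_ k (leqnn k))/= hk] := hn (e / (M.*2.+1)%:R) (divr_gt0 e0 M0).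
have [r rP] := orbit_closure_aligned x y (n k) (n0 k) xy.
exists (n k), (hits_hole x (n k) P M r); split => //.
- exact: hits_hole_periodic.
- apply: (@le_trans _ _ (M.*2.+1 * (holes x (n k) * max_residue_mult P (n k)))%:R).
    by rewrite ler_nat sum_hits_hole_le.
  move: hk; rewrite !ger0_norm ?divr_ge0// !natrM.
  (* Division by 0 gives 0, so a zero multiplicity is treated apart; the bound on the hits is then
     0. *)
  set u := (M.*2.+1)%:R in M0 *; case: (posnP (max_residue_mult P (n k))) => [->|c0].
    by move=> _; rewrite !mulr0 mulr_ge0// ltW.
  rewrite mulrACA -invfM -[X in _ <= X -> _]/(e * _ / _).
  by rewrite ler_pdivlMr ?mulr_gt0 ?ltr0n// mulrCA.
(* On [[-M, M]] the shifts of [y] by [P m] and by [P (m %% n k)] both read [x] at positions of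
   [Per (n k) x] that are congruent modulo [n k], so they agree there. *)
- move=> m; rewrite negb_exists => /forallP noh.
  apply: MP; [exact: orbit_closure_shift..|] => i iM.
  have Pi : Per (n k) x (P.[m%:Z] + (i + r)).
    have iM2 : (`|(i + M%:Z)%R| < M.*2.+1)%N by lia.
    have /asboolPn/contrapT := noh (Ordinal iM2).
    by congr (Per _ _ (_ + _)); rewrite /=; lia.
  have PPm : (P.[m%:Z] + (i + r) = P.[(m %% n k)%N%:Z] + (i + r) %[mod (n k)%:Z])%Z.
    apply/eqP; rewrite eqz_mod_dvd.
    have -> : forall u v w : int, u + w - (v + w) = u - v by move=> *; ring.
    apply: dvdz_trans (dvdz_horner_sub _ _ _).
    rewrite {1}(divn_eq m (n k)) PoszD addrK PoszM.
    exact: dvdz_mull.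
  have Pi' := Per_mod x (n k) _ _ PPm Pi.
  rewrite /left_shift_pow !(addrC i) !rP -!addrA//.
  move/eqP: PPm; rewrite eqz_mod_dvd => /dvdzP[q qE].
  by rewrite (Pi' q) -qE; congr (x _); ring.
Qed.

End PolynomialAverages.

(** * Passage from real to complex observables *)

Lemma Re_real_complexM {R : realType} (a : R) (z : R[i]) :
  complex.Re (a%:C%C * z) = a * complex.Re z.
Proof. by case: z => u v; simpc. Qed.

Lemma Im_real_complexM {R : realType} (a : R) (z : R[i]) :
  complex.Im (a%:C%C * z) = a * complex.Im z.
Proof. by case: z => u v; simpc. Qed.

Theorem theorem6p8 (R : realType) (A : finType) (P : {poly int}) (d : nat)
    (x : fullshift A) (n : nat -> nat) :
  (1 < d)%N -> size P = d.+1 -> P \is monic -> (forall i : nat, 0 <= P`_i) ->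
  toeplitz x -> periodic_structure x n ->
  (fun k : nat => (holes x (n k))%:R : R) =o_\oo
    (fun k : nat => (n k)%:R / (max_residue_mult P (n k))%:R : R) ->
  forall F : fullshift A -> R[i]^o, {within orbit_closure x, continuous F} ->
  forall y : fullshift A, orbit_closure x y ->
  exists l : R[i]^o,
    N%:R^-1 * (\sum_(1 <= m < N.+1) F (left_shift_pow P.[m%:Z] y))
      @[N --> \oo] --> l.
Proof.
move=> _ _ _ _ _ [n0 _ _] hn F Fc y xy.
have ReFc : {within orbit_closure x, continuous (@complex.Re R \o F)}.
  by move=> z; apply: continuous_comp; [exact: Fc|exact: Re_continuous].
have ImFc : {within orbit_closure x, continuous (@complex.Im R \o F)}.
  by move=> z; apply: continuous_comp; [exact: Fc|exact: Im_continuous].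
have /cvg_ex[a aP] := polynomial_average_cvg x y P n _ n0 hn ReFc xy.
have /cvg_ex[b bP] := polynomial_average_cvg x y P n _ n0 hn ImFc xy.
exists (a +i* b)%C.
(* The factor [1/N] is real, so taking real or imaginary parts commutes with averaging. *)
have natC N : N%:R^-1 = (N%:R^-1 : R)%:C%C by rewrite fmorphV rmorph_nat.
apply: cvg_ReIm.
- apply: cvg_trans aP; apply: near_eq_cvg; apply: nearW => N.
  by rewrite natC Re_real_complexM raddf_sum.
- apply: cvg_trans bP; apply: near_eq_cvg; apply: nearW => N.
  by rewrite natC Im_real_complexM raddf_sum.
Qed.
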